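(* Let $\alpha\in(0,1)$, $L>0$, $\Delta_{default}\in\mathbb R$ and $U\ge1$. Then $\mathrm{QrDev}_{\alpha,L,\Delta_{default}}$ is $2L$-Lipschitz resilient, i.e. for all $x\in\mathbb R^U$, all $\Delta\in\mathbb R_{\ge0}^{2U}$ and all $w,w'\in\mathbb R_{\ge0}^U$, $$\left|\mathrm{QrDev}_{\alpha,L,\Delta_{default}}(w,x,\Delta)-\mathrm{QrDev}_{\alpha,L,\Delta_{default}}(w',x,\Delta)\right|\le 2L\,\|w-w'\|_1 .$$
   Context: For $x\in\mathbb R$ and $\Delta=(\Delta_{left},\Delta_{right})\in\mathbb R_{\ge0}^2$, the asymmetric Huber loss is $$\mathrm{Huber}_\alpha(m|x,\Delta)=\begin{cases}\min\{1,\tfrac{1-\alpha}{\alpha}\}\left(\sqrt{\Delta_{left}^2+(x-m)^2}-\Delta_{left}\right) & \text{for } m\le x,\\ \min\{1,\tfrac{\alpha}{1-\alpha}\}\left(\sqrt{\Delta_{right}^2+(m-x)^2}-\Delta_{right}\right) & \text{for } m\ge x.\end{cases}$$ For $w\in\mathbb R_{\ge0}^U$ (voting rights), $x\in\mathbb R^U$ (scores) and $\Delta=(\Delta_{u,left},\Delta_{u,right})_{u\in[U]}\in\mathbb R_{\ge0}^{2U}$ (left and right uncertainties), the quadratically regularized quantile is the unique minimizer $$\mathrm{QrQtl}_{\alpha,L}(w,x,\Delta)=\operatorname*{argmin}_{m\in\mathbb R}\left\{\frac{m^2}{2L}+\sum_{u\in[U]} w_u\,\mathrm{Huber}_\alpha(m|x_u,\Delta_u)\right\},$$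 and the quadratically regularized median is $\mathrm{QrMed}_L(w,x,\Delta)=\mathrm{QrQtl}_{1/2,L}(w,x,\Delta)$. Given a default deviation $\Delta_{default}$ and writing $m=\mathrm{QrMed}_L(w,x,\Delta)$, the quadratically regularized deviation is $$\mathrm{QrDev}_{\alpha,L,\Delta_{default}}(w,x,\Delta)=\Delta_{default}+\mathrm{QrQtl}_{\alpha,L}\left(w,\ \left(|x_u-m|-\Delta_{default}\right)_{u\in[U]},\ \Delta\right).$$ *)

(* Defs.v *)
From HB Require Import structures.
From mathcomp Require Import all_boot all_order all_algebra.
From mathcomp Require Import all_classical all_reals.

Set Implicit Arguments.
Unset Strict Implicit.
Unset Printing Implicit Defensive.

Import Order.TTheory GRing.Theory Num.Theory.

Local Open Scope classical_set_scope.
Local Open Scope ring_scope.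

Section QuadraticallyRegularized.
Context {R : realType}.

(* [D] is the pair (left uncertainty, right uncertainty). For [0 <= D.1] and
   [0 <= D.2] both branches vanish at [m = x], so the overlap of the two cases
   is harmless. *)
Definition Huber (alpha m x : R) (D : R * R) : R :=
  if m <= x
  then Num.min 1 ((1 - alpha) / alpha)
         * (Num.sqrt (D.1 ^+ 2 + (x - m) ^+ 2) - D.1)
  else Num.min 1 (alpha / (1 - alpha))
         * (Num.sqrt (D.2 ^+ 2 + (m - x) ^+ 2) - D.2).

Definition argmin (f : R -> R) : set R := [set m | forall y, f m <= f y].

Definition QrQtl_objective (alpha L : R) (U : nat) (w x : 'I_U -> R)
    (D : 'I_U -> R * R) (m : R) : R :=
  m ^+ 2 / (2 * L) + \sum_(u < U) w u * Huber alpha m (x u) (D u).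

(* For [0 < alpha < 1], [0 < L] and nonnegative [w] and [D], the objective is
   continuous, coercive and strictly convex, so [argmin] is a singleton and the
   default value 0 of [xget] is not used. *)
Definition QrQtl (alpha L : R) (U : nat) (w x : 'I_U -> R)
    (D : 'I_U -> R * R) : R :=
  xget 0 (argmin (QrQtl_objective alpha L w x D)).

Definition QrMed (L : R) (U : nat) (w x : 'I_U -> R) (D : 'I_U -> R * R) : R :=
  QrQtl (1 / 2) L w x D.

Definition QrDev (alpha L Ddefault : R) (U : nat) (w x : 'I_U -> R)
    (D : 'I_U -> R * R) : R :=
  let m := QrMed L w x D in
  Ddefault + QrQtl alpha L w (fun u => `|x u - m| - Ddefault) D.

Definition l1norm (U : nat) (v : 'I_U -> R) : R := \sum_(u < U) `|v u|.

End QuadraticallyRegularized.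

(* Main.v *)
(** The objective is [m^2 / (2L)] plus a [w]-weighted sum of convex 1-Lipschitz
    losses, so it exceeds its minimum by at least [(m - q)^2 / (2L)]. Comparing
    the objectives for [w] and [w'] at both minimizers bounds the displacement
    of a quantile by [L * l1norm (w - w')]. Moving every score by at most [d]
    moves a quantile by at most [d], since increments of convex functions are
    nondecreasing. The deviation is hit once directly through [w] and once
    through the median entering its scores, whence the factor 2. *)

Require Import Defs.
From HB Require Import structures.
From mathcomp Require Import all_boot all_order all_algebra.
From mathcomp Require Import all_classical all_reals.
From mathcomp Require Import topology normedtype derive realfun.
From mathcomp Require Import ring lra.

Set Implicit Arguments.
Unset Strict Implicit.
Unset Printing Implicit Defensive.

Import Order.TTheory GRing.Theory Num.Theory.
Import numFieldTopology.Exports numFieldNormedType.Exports.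

Local Open Scope ring_scope.

(** * Convex and 1-Lipschitz functions on the real line *)

Definition convex_fun (R : realType) (f : R -> R) :=
  forall s t l : R, 0 <= l <= 1 ->
    f ((1 - l) * s + l * t) <= (1 - l) * f s + l * f t.

Definition nonexpansive (R : realType) (f : R -> R) :=
  forall s t : R, `|f s - f t| <= `|s - t|.

(** Both [s + e] and [t] lie between [s] and [t + e], with complementary weights [l] and [1 - l], so
    adding their two convexity inequalities gives the claim. *)
Lemma convex_increment (R : realType) (f : R -> R) (s t e : R) :
  convex_fun f -> s <= t -> 0 < e -> f (s + e) - f s <= f (t + e) - f t.
Proof.
move=> cf st e0; have d0 : 0 < t - s + e by lra.
pose l := e / (t - s + e).
have ld : l * (t - s + e) = e by rewrite /l divfK // gt_eqF.
have l01 : 0 <= l <= 1.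
  by apply/andP; split; [rewrite divr_ge0 ?ltW | rewrite ler_pdivrMr //; lra].
have l01' : 0 <= 1 - l <= 1 by lra.
have := cf s (t + e) l l01; have := cf s (t + e) (1 - l) l01'.
have -> : (1 - (1 - l)) * s + (1 - l) * (t + e) = t by move: ld; clear; lra.
have -> : (1 - l) * s + l * (t + e) = s + e by move: ld; clear; lra.
by lra.
Qed.

Lemma nonexpansive_continuous (R : realType) (f : R -> R) :
  nonexpansive f -> continuous f.
Proof.
move=> lf t; apply/cvgrPdist_le => eps eps0; near=> s.
apply: le_trans (lf t s) _; near: s.
exact: (@cvgr_dist_le _ _ _ (nbhs t) _ id t cvg_id).
Unshelve. all: by end_near. Qed.

(** * The symmetric loss with uncertainty [a] *)

Section PseudoHuber.
Variables (R : realType) (a : R).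
Hypothesis a0 : 0 <= a.

Definition pseudo_huber (t : R) : R := Num.sqrt (a ^+ 2 + t ^+ 2) - a.

Let S t := Num.sqrt (a ^+ 2 + t ^+ 2).

Let S_ge0 t : 0 <= S t. Proof. exact: sqrtr_ge0. Qed.

Let S_sqr t : S t ^+ 2 = a ^+ 2 + t ^+ 2.
Proof. by rewrite sqr_sqrtr // addr_ge0 // sqr_ge0. Qed.

Let S_ge_norm t : `|t| <= S t.
Proof. by rewrite -sqrtr_sqr ler_wsqrtr // lerDr sqr_ge0. Qed.

Lemma pseudo_huber0 : pseudo_huber 0 = 0.
Proof. by rewrite /pseudo_huber expr0n addr0 sqrtr_sqr ger0_norm // subrr. Qed.

Lemma pseudo_huber_ge0 t : 0 <= pseudo_huber t.
Proof.
rewrite subr_ge0 -[leLHS]ger0_norm // -sqrtr_sqr ler_wsqrtr //.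
by rewrite lerDl sqr_ge0.
Qed.

Lemma pseudo_huber_homo s t :
  0 <= s -> s <= t -> pseudo_huber s <= pseudo_huber t.
Proof.
move=> s0 st; rewrite lerB // ler_wsqrtr // lerD2l.
by rewrite ler_pXn2r // nnegrE //; exact: le_trans st.
Qed.

(** [S t] is the Euclidean norm of [(a, t)], so this is a triangle inequality; squared, it reduces
    to [t * (s - t) <= S t * |s - t|]. *)
Lemma pseudo_huber_nonexpansive : nonexpansive pseudo_huber.
Proof.
have key s t : S s <= S t + `|s - t|.
  rewrite -(@ler_pXn2r _ 2) ?nnegrE // ?addr_ge0 //.
  have St := S_ge_norm t.
  have := ler_norm (t * (s - t)); rewrite normrM.
  have := ler_wpM2r (normr_ge0 (s - t)) St.
  have := S_sqr s; have := S_sqr t.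
  have := real_normK (num_real (s - t)).
  nra.
move=> s t; rewrite /pseudo_huber -/(S s) -/(S t).
have := key s t; have := key t s; rewrite (distrC t s) => h1 h2.
by rewrite ler_norml; lra.
Qed.

Lemma pseudo_huber_convex : convex_fun pseudo_huber.
Proof.
move=> s t l /andP[l0 l1]; rewrite /pseudo_huber -/(S _) -/(S s) -/(S t).
suff : S ((1 - l) * s + l * t) <= (1 - l) * S s + l * S t by lra.
have l1' : 0 <= 1 - l by lra.
rewrite -(@ler_pXn2r _ 2) ?nnegrE // ?addr_ge0 ?mulr_ge0 //.
(* Cauchy-Schwarz for [(a, s)] and [(a, t)], which bounds the cross term of the squared claim; the
   squares of the two sides differ by [(a * (s - t)) ^+ 2]. *)
have CS : a ^+ 2 + s * t <= S s * S t.
  have [st|st] := leP (a ^+ 2 + s * t) 0; first exact: le_trans (mulr_ge0 _ _).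
  rewrite -(@ler_pXn2r _ 2) ?nnegrE ?mulr_ge0 // ?(ltW st) //.
  rewrite exprMn !S_sqr; have := sqr_ge0 (a * (s - t)); nra.
rewrite S_sqr.
have -> : ((1 - l) * S s + l * S t) ^+ 2 =
  (1 - l) ^+ 2 * S s ^+ 2 + l ^+ 2 * S t ^+ 2 + 2 * ((1 - l) * l) * (S s * S t).
  by ring.
rewrite !S_sqr.
have := ler_wpM2l (mulr_ge0 l1' l0) CS; nra.
Qed.

End PseudoHuber.

(** * The asymmetric Huber loss *)

Section HuberLoss.
Variables (R : realType) (alpha : R) (D : R * R).
Hypotheses (alpha_gt0 : 0 < alpha) (alpha_lt1 : alpha < 1).
Hypotheses (D1_ge0 : 0 <= D.1) (D2_ge0 : 0 <= D.2).

Let cl : R := Num.min 1 ((1 - alpha) / alpha).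
Let cr : R := Num.min 1 (alpha / (1 - alpha)).

Let cl01 : 0 <= cl <= 1.
Proof.
by rewrite le_min ge_min ler01 lexx /= andbT divr_ge0 // ?subr_ge0 ltW.
Qed.

Let cr01 : 0 <= cr <= 1.
Proof.
by rewrite le_min ge_min ler01 lexx /= andbT divr_ge0 // ?subr_ge0 ltW.
Qed.

(** At most one positive part is nonzero, and [pseudo_huber] vanishes at 0. This form lets each side
    be treated without a case split. *)
Lemma HuberE m x : Huber alpha m x D =
  cl * pseudo_huber D.1 (Num.max 0 (x - m)) +
  cr * pseudo_huber D.2 (Num.max 0 (m - x)).
Proof.
rewrite /Huber; case: leP => mx.
  rewrite (max_r (_ : 0 <= x - m)) ?subr_ge0 // max_l ?subr_le0 //.
  by rewrite pseudo_huber0 // mulr0 addr0.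
rewrite (max_l (_ : x - m <= 0)) ?subr_le0 ?(ltW mx) //.
by rewrite max_r ?subr_ge0 ?(ltW mx) // pseudo_huber0 // mulr0 add0r.
Qed.

Lemma Huber_ge0 m x : 0 <= Huber alpha m x D.
Proof.
by move/andP: cl01 => [? _]; move/andP: cr01 => [? _];
  rewrite HuberE addr_ge0 // mulr_ge0 // pseudo_huber_ge0.
Qed.

Lemma Huber_translation m x : Huber alpha m x D = Huber alpha (m - x) 0 D.
Proof. by rewrite !HuberE subr0 sub0r opprB. Qed.

Lemma Huber_nonexpansive x : nonexpansive (fun m => Huber alpha m x D).
Proof.
move=> s t; rewrite !HuberE.
have := pseudo_huber_nonexpansive D.1 (Num.max 0 (x - s)) (Num.max 0 (x - t)).
have := pseudo_huber_nonexpansive D.2 (Num.max 0 (s - x)) (Num.max 0 (t - x)).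
set p1 := pseudo_huber _ _; set p2 := pseudo_huber _ _.
set p3 := pseudo_huber _ _; set p4 := pseudo_huber _ _ => h2 h1.
have -> : cl * p3 + cr * p1 - (cl * p4 + cr * p2) =
  cl * (p3 - p4) + cr * (p1 - p2) by ring.
(* The distance splits exactly between the two sides of [x], so adding the one-sided bounds keeps
   the constant 1. *)
have -> : `|s - t| = `|Num.max 0 (x - s) - Num.max 0 (x - t)| +
                      `|Num.max 0 (s - x) - Num.max 0 (t - x)|.
  case: (lerP 0 (x - s)) => ?; case: (lerP 0 (x - t)) => ?;
  case: (lerP 0 (s - x)) => ?; case: (lerP 0 (t - x)) => ?;
  case: (lerP 0 (s - t)) => ?; rewrite ?subr0 ?sub0r ?subrr ?normr0 ?normrN;
  repeat match goal with |- context [`|?y|] =>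
    first [rewrite (ger0_norm (_ : 0 <= y)); last by lra
          |rewrite (ler0_norm (_ : y <= 0)); last by lra] end; by lra.
apply: le_trans (ler_normD _ _) _; rewrite !normrM.
move/andP: cl01 => [? ?]; move/andP: cr01 => [? ?].
by apply: lerD; rewrite ger0_norm //;
  [apply: (le_trans _ h1) | apply: (le_trans _ h2)]; rewrite ler_piMl.
Qed.

(** Each side composes a convex function, nondecreasing on nonnegative reals, with a convex positive
    part. *)
Lemma Huber_convex x : convex_fun (fun m => Huber alpha m x D).
Proof.
move=> s t l l01; have /andP[l0 l1] := l01; rewrite !HuberE.
have l1' : 0 <= 1 - l by lra.
have max_convex (u v y : R) : y = (1 - l) * u + l * v ->
    Num.max 0 y <= (1 - l) * Num.max 0 u + l * Num.max 0 v.
  move=> ->; rewrite ge_max addr_ge0 ?mulr_ge0 ?le_max ?lexx //=.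
  by rewrite lerD // ler_wpM2l // le_max lexx orbT.
have conv b u v y : 0 <= b -> y = (1 - l) * u + l * v ->
    pseudo_huber b (Num.max 0 y) <= (1 - l) * pseudo_huber b (Num.max 0 u) +
      l * pseudo_huber b (Num.max 0 v).
  move=> b0 yE; apply: (le_trans _ (pseudo_huber_convex b _ _ l01)).
  by apply: pseudo_huber_homo; rewrite ?max_convex // le_max lexx.
move/andP: cl01 => [c0 _]; move/andP: cr01 => [c0' _].
have e1 : x - ((1 - l) * s + l * t) = (1 - l) * (x - s) + l * (x - t) by ring.
have e2 : (1 - l) * s + l * t - x = (1 - l) * (s - x) + l * (t - x) by ring.
have := ler_wpM2l c0 (conv _ _ _ _ D1_ge0 e1).
have := ler_wpM2l c0' (conv _ _ _ _ D2_ge0 e2).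
by lra.
Qed.

End HuberLoss.

(** * Existence and stability of the regularized quantile *)

Section QuantileObjective.
Variables (R : realType) (alpha L : R) (U : nat) (D : 'I_U -> R * R).
Hypotheses (alpha_gt0 : 0 < alpha) (alpha_lt1 : alpha < 1) (L_gt0 : 0 < L).
Hypothesis D_ge0 : forall u, 0 <= (D u).1 /\ 0 <= (D u).2.

Let L2_gt0 : 0 < 2 * L. Proof. exact: mulr_gt0. Qed.

Lemma QrQtl_objective_continuous (w x : 'I_U -> R) :
  continuous (QrQtl_objective alpha L w x D).
Proof.
move=> m; apply: cvgD.
  by apply: cvgM; [exact: exprn_continuous | exact: cvg_cst].
apply: cvg_big => [[a b]|u _]; first exact: add_continuous.
apply: cvgM; first exact: cvg_cst.
have [D1 D2] := D_ge0 u.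
exact: (nonexpansive_continuous
  (@Huber_nonexpansive _ _ _ alpha_gt0 alpha_lt1 D1 D2 (x u))).
Qed.

Lemma QrQtl_argmin (w x : 'I_U -> R) :
  (forall u, 0 <= w u) -> argmin (QrQtl_objective alpha L w x D)
    (QrQtl alpha L w x D).
Proof.
move=> w0; apply: xgetPex; set F := QrQtl_objective _ _ _ _ _.
have F_ge m : m ^+ 2 / (2 * L) <= F m.
  rewrite lerDl sumr_ge0 // => u _; rewrite mulr_ge0 //.
  by have [? ?] := D_ge0 u; exact: Huber_ge0.
have F00 : 0 <= F 0 by apply: le_trans (F_ge 0); rewrite expr0n mul0r.
(* As [M >= 1], [M ^+ 2 >= M >= 2 * L * F 0]: outside [[-M, M]] the quadratic term alone exceeds
   [F 0], so a minimum over this interval is global. *)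
pose M := 1 + 2 * L * F 0.
have M1 : 1 <= M by rewrite lerDl !mulr_ge0 // ltW.
have [||c _ cmin] := @EVT_min R F (- M) M; first by lra.
  by apply: continuous_subspaceT; exact: QrQtl_objective_continuous.
exists c => y; have [yM|yM] := leP `|y| M.
  by apply: cmin; rewrite in_itv /= -ler_norml.
apply: (@le_trans _ _ (F 0)).
  by apply: cmin; rewrite in_itv /= oppr_le0 (le_trans ler01).
apply: le_trans (F_ge y); rewrite ler_pdivlMr //.
rewrite -(real_normK (num_real y)).
have : M * M <= `|y| ^+ 2 by rewrite expr2 ler_pM ?(ltW yM) // (le_trans ler01).
move: L2_gt0; rewrite {1}/M; nra.
Qed.

(* Compares [q] with [(1 - l) q + l y] by strong convexity, then takes [l]
   small. *)
Lemma QrQtl_growth (w x : 'I_U -> R) (y : R) (q := QrQtl alpha L w x D) :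
  (forall u, 0 <= w u) ->
  QrQtl_objective alpha L w x D q + (y - q) ^+ 2 / (2 * L) <=
    QrQtl_objective alpha L w x D y.
Proof.
move=> w0; have qmin := QrQtl_argmin x w0; rewrite -/q in qmin.
set F := QrQtl_objective _ _ _ _ _ in qmin *.
have sconv l : 0 <= l <= 1 -> F q <=
    (1 - l) * F q + l * F y - l * (1 - l) * ((y - q) ^+ 2 / (2 * L)).
  move=> l01; apply: le_trans (qmin ((1 - l) * q + l * y)) _.
  rewrite /F /QrQtl_objective.
  set H := fun m => \sum_(u < U) w u * Huber alpha m (x u) (D u).
  (* The square satisfies the strong convexity bound with equality, which leaves plain convexity of
     the losses. *)
  suff : H ((1 - l) * q + l * y) <= (1 - l) * H q + l * H y.
    by rewrite /H; lra.
  rewrite /H !mulr_sumr -big_split /=; apply: ler_sum => u _.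
  have [D1 D2] := D_ge0 u.
  have := @Huber_convex _ _ _ alpha_gt0 alpha_lt1 D1 D2 (x u) q y l l01.
  by move/(ler_wpM2l (w0 u)); rewrite /= mulrDr !(mulrCA (w u)).
set B := _ / _ in sconv *; have := qmin y; rewrite leNgt => FqFy.
case: (leP _ (F y)) => // /[dup] lt; rewrite -ltrBlDl => lt'.
have A0 : 0 <= F y - F q by rewrite subr_ge0 leNgt.
set A := F y - F q in lt' A0.
have B0 : 0 < B by exact: le_lt_trans lt'.
(* With this [l], [(1 - l) * B] is the midpoint of [A] and [B], hence exceeds [A], whereas [sconv]
   forces [(1 - l) * B <= A]. *)
pose l := (B - A) / (2 * B).
have lB : l * (2 * B) = B - A by rewrite /l divfK // gt_eqF //; lra.
have l0 : 0 < l by rewrite /l divr_gt0 //; lra.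
have l1 : l <= 1 by rewrite /l ler_pdivrMr; lra.
have := sconv l; rewrite (ltW l0) l1 => /(_ isT).
have : 0 < l * ((1 - l) * B - A) by rewrite mulr_gt0 //; lra.
rewrite /A; lra.
Qed.

Lemma QrQtl_lipschitz_weights (w w' x : 'I_U -> R) :
  (forall u, 0 <= w u) -> (forall u, 0 <= w' u) ->
  `|QrQtl alpha L w x D - QrQtl alpha L w' x D| <=
    L * l1norm (fun u => w u - w' u).
Proof.
move=> w0 w0'; set q := QrQtl _ _ w _ _; set q' := QrQtl _ _ w' _ _.
have := QrQtl_growth x q' w0; have := QrQtl_growth x q w0'.
rewrite -/q -/q' /QrQtl_objective => g' g.
set N := l1norm _.
have hN : \sum_(u < U) (w u - w' u) *
    (Huber alpha q' (x u) (D u) - Huber alpha q (x u) (D u)) <= N * `|q - q'|.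
  rewrite /N mulr_suml; apply: ler_sum => u _.
  apply: le_trans (ler_norm _) _; rewrite normrM ler_wpM2l // distrC.
  by have [? ?] := D_ge0 u; exact: Huber_nonexpansive.
have hS : \sum_(u < U) (w u - w' u) *
    (Huber alpha q' (x u) (D u) - Huber alpha q (x u) (D u)) =
    (\sum_(u < U) w u * Huber alpha q' (x u) (D u)
     - \sum_(u < U) w u * Huber alpha q (x u) (D u))
    - (\sum_(u < U) w' u * Huber alpha q' (x u) (D u)
     - \sum_(u < U) w' u * Huber alpha q (x u) (D u)).
  by rewrite -!sumrB; apply: eq_bigr => u _; ring.
have E : `|q - q'| ^+ 2 / L = 2 * ((q - q') ^+ 2 / (2 * L)).
  by rewrite real_normK ?num_real //; field; rewrite gt_eqF.
(* Adding [g] and [g'] cancels the quadratic terms of the objectives and doubles the growth term. *)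
have : `|q - q'| ^+ 2 / L <= N * `|q - q'|.
  by rewrite E; apply: le_trans hN; rewrite hS; lra.
rewrite ler_pdivrMr // expr2 mulrAC [N * L]mulrC.
have [->|qq] := eqVneq `|q - q'| 0; last by rewrite ler_pM2r // lt_def qq /=.
by rewrite mulr_ge0 ?(ltW L_gt0) // sumr_ge0.
Qed.

(** If [q'] exceeded [q + d] by [e], moving [q] up and [q'] down by [e] would not increase the sum
    of the two objectives, contradicting strict growth at the minimizers. *)
Lemma QrQtl_shift (w x y : 'I_U -> R) (d : R) :
  (forall u, 0 <= w u) -> 0 <= d -> (forall u, y u <= x u + d) ->
  QrQtl alpha L w y D <= QrQtl alpha L w x D + d.
Proof.
move=> w0 d0 yx; rewrite leNgt; apply/negP => lt.
set q' := QrQtl _ _ _ y _ in lt *; set q := QrQtl _ _ _ x _ in lt *.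
pose e := q' - q - d; have e0 : 0 < e by rewrite /e; lra.
have qmin := QrQtl_growth x (q + e) w0.
have qmin' := QrQtl_growth y (q' - e) w0.
rewrite -/q -/q' /QrQtl_objective in qmin qmin'.
have inc : \sum_(u < U) w u * Huber alpha (q + e) (x u) (D u)
     - \sum_(u < U) w u * Huber alpha q (x u) (D u) <=
    \sum_(u < U) w u * Huber alpha q' (y u) (D u)
     - \sum_(u < U) w u * Huber alpha (q' - e) (y u) (D u).
  rewrite -!sumrB; apply: ler_sum => u _; rewrite -!mulrBr ler_wpM2l //.
  have [D1 D2] := D_ge0 u.
  do 2![rewrite (Huber_translation _ _ _ _ (y u)) //].
  do 2![rewrite (Huber_translation _ _ _ _ (x u)) //].
  have -> : q + e - x u = q - x u + e by ring.
  have -> : q' - y u = q' - e - y u + e by ring.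
  apply: (convex_increment (Huber_convex alpha_gt0 alpha_lt1 D1 D2 0)) => //.
  by have := yx u; rewrite /e; lra.
(* The numerator equals [- 2 * d * e], because [q' - q = d + e]. *)
have K : ((q + e) ^+ 2 - q ^+ 2 + (q' - e) ^+ 2 - q' ^+ 2) / (2 * L) <= 0.
  rewrite pmulr_lle0 ?invr_gt0 //.
  by rewrite /e; have := mulr_ge0 d0 (ltW e0); rewrite /e; nra.
have P : 0 < (q + e - q) ^+ 2 / (2 * L).
  by rewrite divr_gt0 // addrAC subrr add0r exprn_gt0.
have P' : 0 <= (q' - e - q') ^+ 2 / (2 * L).
  by rewrite divr_ge0 ?sqr_ge0 // ltW.
lra.
Qed.

Lemma QrQtl_nonexpansive_scores (w x y : 'I_U -> R) (d : R) :
  (forall u, 0 <= w u) -> 0 <= d -> (forall u, `|x u - y u| <= d) ->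
  `|QrQtl alpha L w x D - QrQtl alpha L w y D| <= d.
Proof.
move=> w0 d0 xy; rewrite ler_norml.
have yx u : y u <= x u + d by have := xy u; rewrite ler_norml; lra.
have xy' u : x u <= y u + d by have := xy u; rewrite ler_norml; lra.
have := QrQtl_shift w0 d0 yx; have := QrQtl_shift w0 d0 xy'; lra.
Qed.

End QuantileObjective.

Theorem propositionC8 (R : realType) (alpha L Ddefault : R) (U : nat)
    (halpha0 : 0 < alpha) (halpha1 : alpha < 1) (hL : 0 < L) (hU : (1 <= U)%N)
    (x : 'I_U -> R) (D : 'I_U -> R * R)
    (hD : forall u, 0 <= (D u).1 /\ 0 <= (D u).2)
    (w w' : 'I_U -> R)
    (hw : forall u, 0 <= w u) (hw' : forall u, 0 <= w' u) :
  `|QrDev alpha L Ddefault w x D - QrDev alpha L Ddefault w' x D|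
    <= 2 * L * l1norm (fun u => w u - w' u).
Proof.
rewrite /QrDev; set m := QrMed L w x D; set m' := QrMed L w' x D.
set N := l1norm _.
have h0 : 0 < 1 / 2 :> R by lra.
have h1 : 1 / 2 < 1 :> R by lra.
have mm' : `|m - m'| <= L * N by exact: QrQtl_lipschitz_weights.
pose s p u : R := `|x u - p| - Ddefault.
rewrite -/(s m) -/(s m').
have ss' u : `|s m u - s m' u| <= `|m - m'|.
  rewrite /s (_ : _ - _ = `|x u - m| - `|x u - m'|); last by ring.
  apply: le_trans (ler_dist_dist _ _) _.
  by rewrite (_ : x u - m - _ = - (m - m')) ?normrN //; ring.
have A := QrQtl_lipschitz_weights halpha0 halpha1 hL hD (s m) hw hw'.
have B := QrQtl_nonexpansive_scores halpha0 halpha1 hL hD hw' (normr_ge0 _) ss'.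
rewrite -/N in A.
set a := QrQtl _ _ _ _ _; set b := QrQtl _ _ _ (s m') _ in B *.
(* [c] is intermediate: [a] and [c] differ only in the weights, [c] and [b] only in the center of
   the scores. Each gap is at most [L * N], the second through [mm']. *)
set c := QrQtl _ _ w' (s m) _ in A B.
rewrite (_ : _ - _ = (a - c) + (c - b)); last by ring.
apply: le_trans (ler_normD _ _) _; rewrite -/a in A; lra.
Qed.
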